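(* Let $G$ be a minimal $(d,k;+1)$-digraph with outlier function $o$. Then $G$ satisfies one of the following: (1) $G$ is outlier-regular; (2) the outlier function $o$ of $G$ contains a unique transposition (i.e. exactly one cycle of length $2$); (3) the vertices of $G$ with order $\omega(G)$ form a directed $(k+2)$-cycle (i.e. the subdigraph they induce is a directed $(k+2)$-cycle). In particular, for $k\ge 2$, every $(3,k;+1)$-digraph satisfies one of (1), (2), (3).
   Context: Digraphs are finite and without multiple arcs. A digraph $G$ is $k$-geodetic if for any (not necessarily distinct) vertices $u,v$ there is at most one directed walk from $u$ to $v$ of length at most $k$ (walks of length $0$ count, so there are no directed cycles of length at most $k$). Put $M(d,k)=1+d+d^2+\dots+d^k$. A $(d,k;+1)$-digraph is a $k$-geodetic digraph with minimum out-degree $d$ and order $M(d,k)+1$. In such a digraph (with $d,k\ge2$), for every vertex $u$ there is a unique vertex $o(u)$ with $d(u,o(u))\ge k+1$; $o:V(G)\to V(G)$ is the outlier function. It is known that such $G$ is diregular, that $o$ is an automorphism of $G$, and that there are no $(2,k;+1)$-digraphs for $k\ge 2$ and no $(d,k;+1)$-digraphs with $d\ge 2$ and $k\in\{3,4\}$. The order $\omega(u)$ of a vertex $u$ is the smallest positive integer $r$ with $o^r(u)=u$, and the index of $G$ is $\omega(G)=\min\{\omega(u):u\in V(G)\}$. $G$ is outlier-regular if all cycles of the permutation $o$ have the same length. Minimality: let $k\ge 2$, $k\ne 3,4$, suppose that a $(d,k;+1)$-digraph with $d\ge 2$ exists for this $k$, and let $d'$ be the smallest $d\ge 3$ for which a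 $(d,k;+1)$-digraph exists; any $(d',k;+1)$-digraph is then called a minimal $(d,k;+1)$-digraph. *)

(* Defs.v *)
From HB Require Import structures.
From mathcomp Require Import all_boot.

Set Implicit Arguments.
Unset Strict Implicit.
Unset Printing Implicit Defensive.

(* A digraph is an arc relation [e : rel T] on a finite type [T] of
   vertices: parallel arcs cannot be represented and loops are not excluded. *)

Section Digraphs.
Variables (T : finType) (e : rel T).

(* The walk visits the vertices of [u :: p] in order; its length is [size p]. *)
Definition walk (u v : T) (p : seq T) : bool := path e u p && (last u p == v).

Definition geodetic (k : nat) : Prop :=
  forall (u v : T) (p q : seq T), size p <= k -> size q <= k ->
    walk u v p -> walk u v q -> p = q.

(* d(u, v) >= m, where d(u, v) is infinite if no walk from u to v exists. *)
Definition dist_geq (m : nat) (u v : T) : Prop :=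
  forall p : seq T, walk u v p -> m <= size p.

Definition outdegree (u : T) : nat := #|[set v | e u v]|.

Definition min_outdegree (d : nat) : Prop :=
  (forall u, d <= outdegree u) /\ (exists u, outdegree u = d).

Definition moore_bound (d k : nat) : nat := \sum_(i < k.+1) d ^ i.

(* (d, k; +1)-digraph. *)
Definition excess_one (d k : nat) : Prop :=
  [/\ geodetic k, min_outdegree d & #|T| = (moore_bound d k).+1].

(* [o u] is the unique vertex at distance at least k + 1 from [u]. *)
Definition outlier_function (k : nat) (o : T -> T) : Prop :=
  forall u v : T, dist_geq k.+1 u v <-> v = o u.

(* For n >= 1, the subdigraph induced by S is a directed n-cycle. *)
Definition induces_dicycle (S : {set T}) (n : nat) : Prop :=
  exists c : seq T,
    [/\ uniq c, size c = n, c =i S &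
        {in S &, forall x y, e x y = (y == next c x)}].

End Digraphs.

Definition minimal_excess_one (k : nat) (T : finType) (e : rel T) : Prop :=
  exists d' : nat,
    [/\ 2 <= k, k != 3, k != 4, 3 <= d' & excess_one e d' k] /\
    (forall d : nat, 3 <= d ->
       (exists (T' : finType) (e' : rel T'), excess_one e' d k) -> d' <= d).

(* Cycles and orders are defined for an arbitrary self-map [o] of [T], so that
   bijectivity of the outlier function is not built into a statement. *)
Section Orders.
Variables (T : finType) (o : T -> T).

(* A cycle is represented by its vertex set, which determines it given [o];
   fixed points are cycles of length 1. *)
Definition cycle_of (C : {set T}) : Prop :=
  exists c : seq T, [/\ c != [::], ufcycle o c & C = [set x in c]].

Definition outlier_regular : Prop :=
  forall C D : {set T}, cycle_of C -> cycle_of D -> #|C| = #|D|.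

Definition unique_transposition : Prop :=
  exists! C : {set T}, cycle_of C /\ #|C| = 2.

(* [r] is the smallest positive integer with o^r(u) = u. *)
Definition has_order (u : T) (r : nat) : bool :=
  [&& 0 < r, iter r o u == u & [forall s : 'I_r, (0 < s) ==> (iter s o u != u)]].

Definition has_index (w : nat) : Prop :=
  (exists u, has_order u w) /\ (forall u r, has_order u r -> w <= r).

End Orders.

Definition min_order_dicycle (k : nat) (T : finType) (e : rel T) (o : T -> T) :
    Prop :=
  exists w : nat,
    has_index o w /\ induces_dicycle e [set u | has_order o u w] k.+2.

(* Main.v *)
Require Import Defs.
From HB Require Import structures.
From mathcomp Require Import all_boot.

(* Counting the walks of length 1, ..., k+1 from u to v by their first arc and by
   their last arc gives
     d+(u) + A(o u, v) = d-(v) + #{w in N+(u) : o w = v}.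
   If some in-degree exceeds the common out-degree d, then o takes only two
   values, which it swaps, so that o has a single cycle. Otherwise o is an
   automorphism, and the vertices of least order w are the fixed points of o^w.
   They are closed under o and under the unique short walks, so they induce a
   subdigraph with the outlier function o, which by the same identity is
   diregular, of some degree D <= d. If D = d, the subdigraph is everything; if
   D = 0, it is a transposition of o; if D = 1, it is a (k+2)-cycle; if
   2 < D < d, minimality is violated.

   Degree 2 is impossible. If u -> u1, u2 and neither successor is the outlier
   of the other, let z be the vertex before u2 on the walk from u1 to u2: then
   z -> u2, o(u). Comparing in-neighbours gives o(z) = u1, so u1 -> o(o(u)); by
   symmetry u2 -> o(o(u)), which gives two walks of length 2. So every vertex u
   has successors v and o(v); if v -> w, o(w), then o(v) -> o(w), and again there
   are two walks of length 2, from u to o(w). *)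

Set Implicit Arguments.
Unset Strict Implicit.
Unset Printing Implicit Defensive.

Lemma card2_mem (T : finType) (A : {set T}) a b c :
  #|A| = 2 -> a \in A -> b \in A -> a != b -> c \in A -> c = a \/ c = b.
Proof.
move=> A2 aA bA ab; suff <- : [set a; b] = A.
  by rewrite in_set2 => /orP[] /eqP->; [left | right].
apply/eqP; rewrite eqEcard cards2 ab A2 andbT.
by apply/subsetP => x; rewrite in_set2 => /orP[] /eqP->.
Qed.

(** * Balls and the Moore bound *)

Section Ball.
Variables (T : finType) (e : rel T).

Fixpoint ball (i : nat) (u : T) : {set T} :=
  if i is j.+1 then u |: \bigcup_(w in [set w | e u w]) ball j w else [set u].

Lemma ballP i u v :
  reflect (exists2 p, size p <= i & walk e u v p) (v \in ball i u).
Proof.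
apply: (iffP idP).
  elim: i u => [|i IHi] u /=; rewrite !inE.
    by move/eqP->; exists [::]; rewrite // /walk /= eqxx.
  case/orP => [/eqP->|/bigcupP[w]]; first by exists [::]; rewrite // /walk /= eqxx.
  rewrite inE => euw /IHi[p sp /andP[pp lp]].
  by exists (w :: p); rewrite // /walk /= euw pp.
case=> p; elim: p i u => [|w p IHp] [|i] //=.
- by move=> u _ /andP[_ /eqP <-]; rewrite inE.
- by move=> u _ /andP[_ /eqP <-]; rewrite !inE eqxx.
- move=> u sp /andP[/= /andP[euw pp] lp]; rewrite inE; apply/orP; right.
  by apply/bigcupP; exists w; rewrite ?inE // IHp // /walk pp.
Qed.

Lemma dist_geq_ball k u v : dist_geq e k.+1 u v <-> v \notin ball k u.
Proof.
split=> [duv|/negP uv p uvp]; last first.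
  by rewrite ltnNge; apply/negP => sp; apply: uv; apply/ballP; exists p.
by apply/negP => /ballP[p sp /duv]; rewrite ltnNge sp.
Qed.

Lemma walk_cons u v w p : walk e u v (w :: p) = e u w && walk e w v p.
Proof. by rewrite /walk /= andbA. Qed.

Lemma walk_rcons u v w p :
  walk e u v (rcons p w) = walk e u (last u p) p && e (last u p) w && (w == v).
Proof. by rewrite /walk rcons_path last_rcons eqxx andbT. Qed.

Lemma geodetic_closed k u p :
  geodetic e k -> size p <= k -> walk e u u p -> p = [::].
Proof. by move=> geo sp up; apply: (geo u u) => //; rewrite /walk /= eqxx. Qed.

(** A vertex common to the balls around two out-neighbours would end two short walks from [u], and
    [u] itself in such a ball would close a short walk. So the union is disjoint and avoids [u]. *)
Lemma card_ball k i u : geodetic e k -> i < k ->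
  #|ball i.+1 u| = (\sum_(w | e u w) #|ball i w|).+1.
Proof.
move=> geo ik /=; rewrite cardsU1.
have -> : u \notin \bigcup_(w in [set w | e u w]) ball i w.
  apply/bigcupP => -[w]; rewrite inE => euw /ballP[p sp wp].
  have := @geodetic_closed k u (w :: p) geo.
  by rewrite walk_cons euw wp /= => /(_ (leq_ltn_trans sp ik) isT).
rewrite add1n; congr _.+1.
rewrite -sum1_card; transitivity (\sum_(w | e u w) \sum_(v in ball i w) 1); last first.
  by apply: eq_bigr => w _; rewrite sum1_card.
rewrite (exchange_big_dep (mem (\bigcup_(w in [set w | e u w]) ball i w))) /=.
  apply: eq_bigr => v /bigcupP[w]; rewrite inE => euw vw.
  rewrite (big_pred1 w) // => w' /=; apply/andP/eqP => [[euw' vw']|-> //].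
  have [p sp wp] := ballP _ _ _ vw; have [q sq wq] := ballP _ _ _ vw'.
  suff [] : w' :: q = w :: p by [].
  by apply: (geo u v); rewrite ?walk_cons ?euw ?euw' //= (leq_ltn_trans _ ik).
by move=> w v euw vw; apply/bigcupP; exists w; rewrite ?inE.
Qed.

Lemma moore_boundS d i : moore_bound d i.+1 = (d * moore_bound d i).+1.
Proof.
rewrite /moore_bound big_ord_recl expn0 add1n big_distrr /=; congr _.+1.
by apply: eq_bigr => j _; rewrite expnS.
Qed.

Lemma moore_bound0 k : moore_bound 0 k = 1.
Proof. by case: k => [|k]; rewrite ?moore_boundS // /moore_bound big_ord1. Qed.

Lemma moore_bound1 k : moore_bound 1 k = k.+1.
Proof.
rewrite /moore_bound (eq_bigr (fun=> 1)) => [|i _]; last exact: exp1n.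
by rewrite sum_nat_const card_ord muln1.
Qed.

Lemma leq_card_ball k d i u : geodetic e k -> (forall v, d <= outdegree e v) ->
  i <= k -> moore_bound d i <= #|ball i u|.
Proof.
move=> geo dmin; elim: i u => [|i IHi] u ik.
  by rewrite /moore_bound big_ord_recl big_ord0 cards1.
rewrite moore_boundS (card_ball u geo) // ltnS.
apply: (@leq_trans (\sum_(w | e u w) moore_bound d i)).
  by rewrite sum_nat_const leq_mul2r -cardsE dmin orbT.
by apply: leq_sum => w _; apply: IHi; apply: ltnW.
Qed.

Lemma card_ball_regular k d i u : geodetic e k -> (forall v, outdegree e v = d) ->
  i <= k -> #|ball i u| = moore_bound d i.
Proof.
move=> geo reg; elim: i u => [|i IHi] u ik.
  by rewrite /moore_bound big_ord_recl big_ord0 cards1.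
rewrite moore_boundS (card_ball u geo) //; congr _.+1.
rewrite (eq_bigr (fun _ => moore_bound d i)) => [|w _]; last by rewrite IHi // ltnW.
by rewrite sum_nat_const -cardsE -(reg u).
Qed.

End Ball.

(** * Walks and degrees in terms of the outlier function *)

Section Outlier.
Variables (T : finType) (e : rel T) (k : nat) (o : T -> T).
Hypotheses (geo : geodetic e k) (ho : outlier_function e k o).

Definition indegree v := #|[set w | e w v]|.

Lemma ball_outlier u : ball e k u = [set~ o u].
Proof.
apply/setP => v; rewrite !inE -[LHS]negbK; congr negb.
by apply/idP/eqP => [/dist_geq_ball /ho|/ho /dist_geq_ball].
Qed.

Lemma walk_outlier u v : v != o u -> exists2 p, size p <= k & walk e u v p.
Proof. by move=> vu; apply/ballP; rewrite ball_outlier !inE. Qed.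

Lemma outlier_walk u v p : walk e u v p -> size p <= k -> v != o u.
Proof.
by move=> uvp sp; have : v \in ball e k u;
  [apply/ballP; exists p | rewrite ball_outlier !inE].
Qed.

Lemma outlier_neq u : o u != u.
Proof.
by rewrite eq_sym; apply: (@outlier_walk u u [::]); rewrite // /walk /= eqxx.
Qed.

Lemma card_outlier_regular d :
  (forall v, outdegree e v = d) -> 0 < #|T| -> #|T| = (moore_bound d k).+1.
Proof.
move=> reg /card_gt0P[u _].
by rewrite -(card_ball_regular u geo reg) // ball_outlier cardsC1 prednK //;
  apply/card_gt0P; exists u.
Qed.

(** The ball of radius [k] misses only [o u], so its size is exactly the Moore bound. This leaves no
    room for more than [d] disjoint balls around out-neighbours. *)
Lemma excess_one_outdegree d : 0 < k -> excess_one e d k ->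
  forall u, outdegree e u = d.
Proof.
move=> k0 [_ [dmin _] cT] u; apply/eqP; rewrite eqn_leq dmin andbT leqNgt.
apply/negP => du; have : #|ball e k u| = moore_bound d k.
  by rewrite ball_outlier cardsC1 cT.
case: k k0 geo => // i _ geo'; rewrite moore_boundS (card_ball u geo') // => -[E].
have : \sum_(w | e u w) moore_bound d i <= \sum_(w | e u w) #|ball e i w|.
  by apply: leq_sum => w _; apply: (leq_card_ball _ geo').
rewrite E sum_nat_const leq_mul2r -cardsE leqNgt du orbF.
by rewrite /moore_bound big_ord_recl.
Qed.

Lemma degree_identity u v :
  outdegree e u + e (o u) v = indegree v + #|[set w | e u w & o w == v]|.
Proof.
(* [X] holds the first vertices after [u], and [Y] the last vertices before [v], on the walks of
   length 1 to [k.+1] from [u] to [v]. *)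
pose X := [set w | e u w & o w != v]; pose Y := [set w | e w v & o u != w].
have EX : outdegree e u = #|X| + #|[set w | e u w & o w == v]|.
  rewrite /outdegree -(cardsID [set w | o w != v] [set w | e u w]).
  by congr (_ + _); apply: eq_card => w; rewrite !inE ?negbK // andbC.
have EY : indegree v = #|Y| + e (o u) v.
  rewrite /indegree -(cardsID [set w | o u != w] [set w | e w v]).
  congr (_ + _); first by apply: eq_card => w; rewrite !inE.
  case: (boolP (e (o u) v)) => euv.
    apply/eqP/cards1P; exists (o u); apply/setP => w; rewrite !inE negbK eq_sym.
    by case: eqP => // ->.
  apply/eqP; rewrite cards_eq0; apply/eqP/setP => w; rewrite !inE negbK.
  by case: eqP => //= <-; apply: negbTE.
suff EXY : #|X| = #|Y| by rewrite EX EY EXY addnAC.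
apply/eqP; rewrite eqn_leq; apply/andP; split.
  have /fin_all_exists[p pP] w :
      exists p, w \in X -> size p <= k /\ walk e w v p.
    case: (boolP (w \in X)) => [|_]; last by exists [::].
    by rewrite inE eq_sym => /andP[_ /walk_outlier[p sp wp]]; exists p.
  (* [f w] is the vertex before [v] on the walk through [w]. Without its end [v] that walk has
     length at most [k], so it is the only one from [u] to [f w], and [f w] determines [w]. *)
  pose f w := last u (belast w (p w)).
  have fP w : w \in X -> walk e u (f w) (belast w (p w)) /\ e (f w) v.
    move=> wX'; have [sp] := pP w wX'; rewrite inE in wX'.
    move=> wp; have lw : last w (p w) = v by case/andP: wp => _ /eqP.
    have := walk_cons e u v w (p w); rewrite wp lastI lw walk_rcons eqxx !andbT.
    by case/andP: wX' => -> _ /= /andP.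
  have finj : {in X &, injective f}.
    move=> w1 w2 w1X w2X fE.
    have [b1 _] := fP _ w1X; have [b2 _] := fP _ w2X; rewrite -fE in b2.
    have [s1 /andP[_ /eqP l1]] := pP _ w1X; have [s2 /andP[_ /eqP l2]] := pP _ w2X.
    suff [] : w1 :: p w1 = w2 :: p w2 by [].
    rewrite !lastI l1 l2; congr rcons.
    by apply: (geo _ _ b1 b2); rewrite size_belast.
  rewrite -(card_in_imset finj); apply/subset_leq_card/subsetP => _ /imsetP[w wX' ->].
  have [b ev] := fP _ wX'; rewrite inE ev eq_sym; apply: (outlier_walk b).
  by rewrite size_belast; have [] := pP _ wX'.
have /fin_all_exists[p pP] w :
    exists p, w \in Y -> size p <= k /\ walk e u w p.
  case: (boolP (w \in Y)) => [|_]; last by exists [::].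
  by rewrite inE eq_sym => /andP[_ /walk_outlier[p sp wp]]; exists p.
(* The reverse map: extend the walk from [u] to [w] by [v], then take its first vertex after [u].
   The list is nonempty, so the default of [head] never shows. *)
pose q w := behead (rcons (p w) v).
pose f w := head v (rcons (p w) v).
have fq w : f w :: q w = rcons (p w) v by rewrite /f /q; case: (p w).
have fP w : w \in Y -> e u (f w) /\ walk e (f w) v (q w).
  move=> wY'; have [sp wp] := pP w wY'; rewrite inE in wY'.
  have lw : last u (p w) = w by case/andP: wp => _ /eqP.
  apply/andP; rewrite -walk_cons fq walk_rcons lw wp eqxx andbT /=.
  by case/andP: wY'.
have sq w : size (q w) = size (p w) by rewrite size_behead size_rcons.
have finj : {in Y &, injective f}.
  move=> w1 w2 w1Y w2Y fE.
  have [_ b1] := fP _ w1Y; have [_ b2] := fP _ w2Y; rewrite -fE in b2.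
  have [s1 /andP[_ /eqP <-]] := pP _ w1Y; have [s2 /andP[_ /eqP <-]] := pP _ w2Y.
  have /rcons_inj[-> //] : rcons (p w1) v = rcons (p w2) v.
  by rewrite -!fq fE; congr (_ :: _); apply: (geo _ _ b1 b2); rewrite sq.
rewrite -(card_in_imset finj); apply/subset_leq_card/subsetP => _ /imsetP[w wY' ->].
have [b ev] := fP _ wY'; rewrite inE b eq_sym; apply: (outlier_walk ev).
by rewrite sq; have [] := pP _ wY'.
Qed.

Lemma sum_indegree : \sum_v indegree v = \sum_v outdegree e v.
Proof.
have E1 v : indegree v = \sum_(w | e w v) 1 by rewrite sum1dep_card.
have E2 v : outdegree e v = \sum_(w | e v w) 1 by rewrite sum1dep_card.
rewrite (eq_bigr _ (fun v _ => E1 v)) [RHS](eq_bigr _ (fun v _ => E2 v)).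
exact: (exchange_big_dep predT).
Qed.

Lemma card_outlier_inj u v :
  injective o -> #|[set w | e u w & o w == o v]| = e u v.
Proof.
move=> oI; case: (boolP (e u v)) => euv.
  apply/eqP/cards1P; exists v; apply/setP => w; rewrite !inE inj_eq //.
  by case: eqP => [->|]; rewrite ?euv ?andbF.
apply/eqP; rewrite cards_eq0; apply/eqP/setP => w; rewrite !inE inj_eq //.
by case: eqP => [->|]; rewrite ?(negbTE euv) ?andbF.
Qed.

(** * Regularity, and the outlier function as an automorphism *)

Hypothesis k2 : 1 < k.

Lemma geodetic_irreflexive u : e u u = false.
Proof.
apply/negP => euu; suff : [:: u] = [::] by [].
by apply: (@geodetic_closed _ e k u); rewrite ?(ltnW k2) // /walk /= euu eqxx.
Qed.

Lemma outlier_not_arc u : e u (o u) = false.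
Proof.
apply/negP => E; have := @outlier_walk u (o u) [:: o u].
by rewrite /walk /= E !eqxx (ltnW k2) => /(_ isT isT).
Qed.

Lemma geodetic_arc_walk u v w : e u v -> e v w -> e u w = false.
Proof.
move=> euv evw; apply/negP => euw; suff : [:: v; w] = [:: w] by [].
by apply: (@geo u w); rewrite /= ?(ltnW k2) // /walk /= ?euv ?evw ?euw eqxx.
Qed.

Lemma geodetic_two_walk u v v' w : e u v -> e v w -> e u v' -> e v' w -> v = v'.
Proof.
move=> euv evw euv' evw'; suff [] : [:: v; w] = [:: v'; w] by [].
by apply: (@geo u w); rewrite // /walk /= ?euv ?evw ?euv' ?evw' eqxx.
Qed.

(** With equal degrees the identity makes every out-neighbour of an outlier an outlier. Walks from
    [o u] reach all vertices except [o (o u)], so [o] is onto, hence injective by finiteness. *)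
Lemma regular_outlier_inj d :
  (forall v, outdegree e v = d) -> (forall v, indegree v = d) -> injective o.
Proof.
move=> outd ind.
have E u v : e (o u) v = #|[set w | e u w & o w == v]| :> nat.
  by apply/eqP; rewrite -(eqn_add2l d) -{1}(outd u) degree_identity ind.
have oarc u v : e (o u) v -> v \in codom o.
  move=> euv; have : 0 < #|[set w | e u w & o w == v]| by rewrite -E euv.
  by case/card_gt0P => w; rewrite inE => /andP[_ /eqP <-]; apply: codom_f.
have owalk p u v : walk e (o u) v p -> v \in codom o.
  elim: p u => [|w p IHp] u; first by move=> /andP[_ /eqP <-]; apply: codom_f.
  by rewrite walk_cons => /andP[/oarc /codomP[w' ->]] /IHp.
have osurj (u v : T) : v \in codom o.
  have [->|/walk_outlier[p _ /owalk //]] := eqVneq v (o (o u)).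
  exact: codom_f.
move=> x y oxy; have /imset_injP H : #|o @: [set: T]| == #|[set: T]|.
  suff -> : o @: [set: T] = [set: T] by [].
  apply/setP => v; rewrite inE; have /codomP[w ->] := osurj x v.
  by rewrite imset_f.
by apply: (H x y) => //; rewrite inE.
Qed.

Lemma outlier_aut d : (forall v, outdegree e v = d) -> (forall v, indegree v = d) ->
  forall u v, e (o u) (o v) = e u v.
Proof.
move=> outd ind u v; have oI := regular_outlier_inj outd ind.
have := degree_identity u (o v); rewrite outd ind card_outlier_inj //.
by move/addnI; case: (e _ _) (e _ _) => [] [].
Qed.

Lemma outlier_cycle_pair (C : {set T}) :
  (forall u u', o u' = o u \/ o u' = o (o u)) -> cycle_of o C -> #|C| = 2.
Proof.
move=> oE [[|x c] [] // _ /andP[cyc uc] ->].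
have img y : y \in x :: c -> exists z, y = o z.
  by move=> yc; exists (prev (x :: c) y); apply/esym/eqP/(prev_cycle cyc).
rewrite (_ : [set _ in _] = [set x; o x]).
  by rewrite cards2 eq_sym outlier_neq.
have xc : x \in x :: c by rewrite mem_head.
apply/setP => y; rewrite in_set in_set2; apply/idP/orP => [yc|[] /eqP-> //].
  have [[y' ->] [x' ->]] := (img _ yc, img _ xc).
  by case: (oE x' y') => ->; rewrite eqxx; [left | right].
exact: mem_fcycle cyc x xc.
Qed.

(* A vertex of in-degree more than d is an out-neighbour of every outlier. It
   follows that all outliers have the same out-neighbours, so that each is the
   only possible outlier of any other. *)
Lemma irregular_outliers d v : (forall u, outdegree e u = d) -> d < indegree v ->
  forall u u', o u' = o u \/ o u' = o (o u).
Proof.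
move=> outd dv.
have arc_v u : e (o u) v.
  have := degree_identity u v; rewrite outd; case: (e _ v) => //.
  by rewrite addn0 => E; move: dv; rewrite E -ltn_subRL subnn.
(* If [w] is an outlier, then [w] has an arc to [v], as [o u] has, which contradicts geodeticity.
   Otherwise the count in the identity vanishes, and the identity gives [e (o u) w] a value
   independent of [u]. *)
have same u u' w : e (o u) w -> e (o u') w.
  move=> euw; have [/codomP[w' ww']|nw] := boolP (w \in codom o).
    by have := arc_v u; rewrite (geodetic_arc_walk euw) // ww' arc_v.
  have m0 x : #|[set y | e x y & o y == w]| = 0.
    apply/eqP; rewrite cards_eq0; apply/eqP/setP => y; rewrite !inE.
    by apply/andP => -[_ /eqP yw]; rewrite -yw codom_f in nw.
  have := degree_identity u w; have := degree_identity u' w.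
  by rewrite !outd !m0 euw => <- /addnI; case: (e _ w).
(* A nonempty short walk from [o u] to [o u'] could start at [o u'] instead, by its first arc, and
   would become a short closed walk. *)
move=> u u'; have [->|/walk_outlier[[|w p] sp]] := eqVneq (o u') (o (o u)).
- by right.
- by move=> /andP[_ /eqP <-]; left.
rewrite walk_cons => /andP[euw wp].
have : w :: p = [::].
  by apply: (@geodetic_closed _ e k (o u')); rewrite ?walk_cons ?(same u u' w euw).
by [].
Qed.

Lemma outlier_dichotomy d : (forall u, outdegree e u = d) ->
  outlier_regular o \/ forall v, indegree v = d.
Proof.
move=> outd; have [/forallP le|] := boolP [forall v, indegree v <= d].
  right; have /leqif_sum/eq_leqif := fun v (_ : predT v) => leqif_eq (le v).
  rewrite sum_indegree (eq_bigr _ (fun v _ => outd v)) eqxx => /esym/forallP H v.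
  exact/eqP/(implyP (H v)).
rewrite negb_forall => /existsP[v]; rewrite -ltnNge => dv; left => C D cC cD.
by rewrite !outlier_cycle_pair //; apply: irregular_outliers dv.
Qed.

Section Automorphism.
Hypotheses (oI : injective o) (oA : forall u v, e (o u) (o v) = e u v).

(** In the identity at [u] and [o v'], with [v = o v'], the correction terms are [e (o u) (o v')]
    and [e u v'], which agree. No regularity is assumed, so this applies to the fixed subdigraph. *)
Lemma outdegree_indegree u v : outdegree e u = indegree v.
Proof.
have := degree_identity u v; rewrite -(f_finv oI v) card_outlier_inj // oA.
exact: addIn.
Qed.

(** * Exclusion of degree two *)

Section DegreeTwo.
Hypotheses (out2 : forall u, outdegree e u = 2) (in2 : forall u, indegree u = 2).

Lemma out2P u a b c : e u a -> e u b -> a != b -> e u c -> c = a \/ c = b.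
Proof.
move=> ua ub ab uc.
by apply: (card2_mem (out2 u)); rewrite ?inE.
Qed.

Lemma in2P u a b c : e a u -> e b u -> a != b -> e c u -> c = a \/ c = b.
Proof.
move=> ua ub ab uc.
by apply: (card2_mem (in2 u)); rewrite ?inE.
Qed.

Lemma out2_other u a : e u a -> exists2 b, e u b & b != a.
Proof.
move=> ua; have /eqP/cards2P[x [y [xy E]]] := out2 u.
have ex z : e u z = (z == x) || (z == y) by rewrite -in_set2 -E inE.
have := ua; rewrite ex => /orP[]/eqP->.
  by exists y; rewrite 1?eq_sym // ex eqxx orbT.
by exists x; rewrite // ex eqxx.
Qed.

(* z is the vertex before u2 on the walk from u1 to u2, which has length k; its
   other out-neighbour is o u, as it cannot be within distance k of u. *)
Lemma degree2_common_in u u1 u2 :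
  e u u1 -> e u u2 -> u1 != u2 -> u2 != o u1 ->
  exists z, [/\ z != u, e z u2 & e z (o u)].
Proof.
move=> uu1 uu2 u12 /walk_outlier[]; case/lastP => [|p z'].
  by move=> _ /andP[_ /eqP /= E]; rewrite E eqxx in u12.
rewrite size_rcons walk_rcons => sp /andP[/andP[]].
set z := last u1 p => u1z zu2 /eqP E; rewrite {}E in zu2.
have uz : z != u.
  apply: contraTneq u1z => ->; apply/negP => u1u.
  suff : u1 :: p = [::] by [].
  by apply: (@geodetic_closed _ e k u); rewrite ?walk_cons ?uu1.
have kp : k <= (size p).+1.
  rewrite leqNgt; apply/negP => pk.
  have : u1 :: rcons p u2 = [:: u2].
    apply: (@geo u u2); rewrite /= ?size_rcons ?(ltnW k2) //.
      by rewrite walk_cons uu1 walk_rcons u1z zu2 eqxx.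
    by rewrite walk_cons uu2 /walk /= eqxx.
  by case=> E; rewrite E eqxx in u12.
have [y zy yu2] := out2_other zu2.
(* A short walk from [u] to [y] through [u1] would continue to [y] in fewer than [k] steps, against
   the unique walk through [z], which takes at least [k]. One through [u2] would give a second short
   walk from [z] to [y]. *)
exists z; split => //; have [<- //|/walk_outlier[[|w q] sq]] := eqVneq y (o u).
  move=> /andP[_ /eqP /= E]; rewrite -E in zy.
  by have := geodetic_arc_walk zy uu2; rewrite zu2.
rewrite walk_cons => /andP[uw wq].
case: (out2P uu1 uu2 u12 uw) => E; rewrite {}E in wq.
  have : rcons p y = q.
    apply: (@geo u1 y) => //; rewrite ?size_rcons //; first exact: ltnW.
    by rewrite walk_rcons u1z zy eqxx.
  by move=> E; move: sq; rewrite /= -E size_rcons ltnNge (leq_trans kp).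
have : [:: y] = u2 :: q.
  apply: (@geo z y); rewrite /= ?(ltnW k2) //.
    by rewrite /walk /= zy eqxx.
  by rewrite walk_cons zu2.
by case=> E _; rewrite E eqxx in yu2.
Qed.

Lemma degree2_second_out u u1 u2 :
  e u u1 -> e u u2 -> u1 != u2 -> u2 != o u1 -> u1 != o u2 -> e u1 (o (o u)).
Proof.
move=> uu1 uu2 u12 u2o u1o.
have [z [zu zu2 zou]] := degree2_common_in uu1 uu2 u12 u2o.
have oz_z : o z != z by apply: outlier_neq.
have ou_u2 : o u != u2.
  by apply: contraTneq uu2 => <-; rewrite outlier_not_arc.
(* This allows a second use of [degree2_common_in], at [z] with successors [o u] and [u2]. The
   vertex [w] it yields is an in-neighbour of [u2] other than [z], so it is [u]. *)
have zA : u2 != o (o u).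
  apply/eqP => E; have : e (o z) u2 by rewrite E oA.
  case/(in2P uu2 zu2 _) => [|ozu|ozz]; first by rewrite eq_sym.
    have : e u (o u2) by rewrite -ozu oA.
    case/(out2P uu1 uu2 u12) => E'; first by rewrite E' eqxx in u1o.
    by have := outlier_neq u2; rewrite E' eqxx.
  by rewrite ozz eqxx in oz_z.
have [w [wz wu2 woz]] := degree2_common_in zou zu2 ou_u2 zA.
have wu : w = u.
  case: (in2P uu2 zu2 _ wu2); rewrite 1?eq_sym // => E.
  by rewrite E eqxx in wz.
rewrite {}wu in woz.
case: (out2P uu1 uu2 u12 woz) => E; first by rewrite -E oA.
by have := outlier_not_arc z; rewrite E zu2.
Qed.

Lemma degree2_successors u u1 u2 :
  e u u1 -> e u u2 -> u1 != u2 -> u2 = o u1 \/ u1 = o u2.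
Proof.
move=> uu1 uu2 u12; have [->|a] := eqVneq u2 (o u1); first by left.
have [->|b] := eqVneq u1 (o u2); first by right.
have u21 : u2 != u1 by rewrite eq_sym.
have E := geodetic_two_walk uu1 (degree2_second_out uu1 uu2 u12 a b) uu2
  (degree2_second_out uu2 uu1 u21 b a).
by rewrite E eqxx in u12.
Qed.

Lemma degree2_absurd (u : T) : False.
Proof.
have ex v : exists2 w, e v w & e v (o w).
  have [a va] : exists a, e v a.
    have : 0 < outdegree e v by rewrite out2.
    by case/card_gt0P => a; rewrite inE; exists a.
  have [b vb ba] := out2_other va.
  by case: (degree2_successors vb va ba) => E; [exists b | exists a]; rewrite -?E.
have [v uv uov] := ex u; have [w vw vow] := ex v.
have ovow : e (o v) (o w) by rewrite oA.
have := geodetic_two_walk uv vow uov ovow.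
by move/esym/eqP; rewrite (negbTE (outlier_neq v)).
Qed.

End DegreeTwo.

(** The arcs are the graph of an injective [f], and the orbit of [u] under [f] is the whole vertex
    set, of size [moore_bound 1 k + 1], that is [k.+2]. *)
Lemma degree1_dicycle (u : T) :
  (forall v, outdegree e v = 1) -> induces_dicycle e [set: T] k.+2.
Proof.
move=> out1.
have in1 v : indegree v = 1 by rewrite -(outdegree_indegree v).
have [f fP] : exists f, forall x y, e x y = (y == f x).
  have /fin_all_exists[f fP] x : exists y, forall z, e x z = (z == y).
    have /eqP/cards1P[y E] := out1 x.
    by exists y => z; rewrite -in_set1 -E inE.
  by exists f.
have fI : injective f.
  move=> x y fxy; have /eqP/cards1P[z E] := in1 (f x).
  have ez w : (w == z) = e w (f x) by rewrite -in_set1 -E inE.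
  have /eqP-> : x == z by rewrite ez fP.
  by apply/esym/eqP; rewrite ez fP fxy.
have reach v : v != o u -> v \in orbit f u.
  move=> /walk_outlier[p _]; rewrite -fconnect_orbit.
  elim: p u => [|w p IHp] x; first by move=> /andP[_ /eqP /= ->].
  rewrite walk_cons fP => /andP[/eqP-> /IHp].
  exact/connect_trans/fconnect1.
have full v : v \in orbit f u.
  have [->|/reach //] := eqVneq v (o u).
  (* The predecessor of [o u] is not [o u], as there are no loops, so a short walk from [u] reaches
     it. *)
  have fo : fconnect f u (finv f (o u)).
    rewrite fconnect_orbit; apply: reach; apply/negP => /eqP E.
    by have := geodetic_irreflexive (o u); rewrite fP -{2}E f_finv ?eqxx.
  rewrite -fconnect_orbit; apply: (connect_trans fo).
  by rewrite -{2}(f_finv fI (o u)) fconnect1.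
exists (orbit f u); split; first exact: orbit_uniq.
- rewrite -(card_uniqP (orbit_uniq f u)).
  have -> : #|orbit f u| = #|T| by apply: eq_card => v; rewrite full.
  rewrite (card_outlier_regular out1); last by apply/card_gt0P; exists u.
  by rewrite moore_bound1.
- by move=> v; rewrite full inE.
- move=> x y _ _; rewrite fP.
  by have /eqP <- := next_cycle (cycle_orbit fI u) (full x).
Qed.

End Automorphism.

End Outlier.

(** * The subdigraph induced on the fixed vertices of an arc-preserving map that commutes with
    [o] *)

Section FixedSubdigraph.
Variables (T : finType) (e : rel T) (k : nat) (o : T -> T).
Hypotheses (geo : geodetic e k) (ho : outlier_function e k o).
Variables (f : T -> T) (S : {set T}).
Hypotheses (SE : forall u, (u \in S) = (f u == u)).
Hypotheses (fA : forall u v, e u v -> e (f u) (f v)).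
Hypotheses (fo : forall u, f (o u) = o (f u)).

Local Notation sT := {u : T | u \in S}.

Definition sub_rel : rel sT := relpre val e.

Lemma outlier_fixed u : u \in S -> o u \in S.
Proof. by rewrite !SE fo => /eqP->. Qed.

Definition sub_outlier (u : sT) : sT := Sub (o (val u)) (outlier_fixed (valP u)).

Lemma walk_sub_rel u v p : walk sub_rel u v p = walk e (val u) (val v) (map val p).
Proof. by rewrite /walk path_map last_map (inj_eq val_inj). Qed.

Lemma sub_geodetic : geodetic sub_rel k.
Proof.
move=> u v p q sp sq; rewrite !walk_sub_rel => up uq; apply: (inj_map val_inj).
by apply: (@geo (val u) (val v)); rewrite ?size_map.
Qed.

(** The map [f] sends a short walk between fixed vertices to a walk with the same length and ends.
    By uniqueness it fixes every vertex of the walk, which therefore stays inside [S]. *)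
Lemma sub_outlier_function : outlier_function sub_rel k sub_outlier.
Proof.
move=> u v; split=> [duv|-> p]; last first.
  by rewrite walk_sub_rel -(size_map val); apply: (proj2 (ho _ _)).
apply/eqP; rewrite -(inj_eq val_inj) /=; apply: contraT.
move=> /(walk_outlier ho)[p sp wp].
have fp : map f p = p.
  apply: (@geo (val u) (val v)); rewrite ?size_map //.
  have /eqP fu : f (val u) == val u by rewrite -SE (valP u).
  have /eqP fv : f (val v) == val v by rewrite -SE (valP v).
  rewrite /walk -{1 2}fu last_map path_map -fv.
  case/andP: wp => pp /eqP ->; rewrite eqxx andbT.
  by apply: sub_path pp => x y; apply: fA.
have pS x : x \in p -> x \in S.
  by move: fp; rewrite SE -{2}(map_id p) => /eq_in_map fp /fp /= ->.
have [q qE] : exists q : seq sT, p = map val q.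
  exists (pmap insub p); rewrite (pmap_filter (insubK _)); apply/esym/all_filterP.
  by apply/allP => x /pS xS; rewrite /= insubT.
have := duv q; rewrite walk_sub_rel -qE ltnNge -(size_map val) -qE sp.
by move=> /(_ wp).
Qed.

End FixedSubdigraph.

(** * Cycle lengths and orders of vertices *)

Section Orders.
Variables (T : finType) (o : T -> T).

Lemma card_cycle C u : cycle_of o C -> u \in C -> #|C| = order o u.
Proof.
move=> [c [_ /andP[cyc uc] ->]]; rewrite inE => uinc.
by rewrite (order_cycle cyc uc uinc) -(card_uniqP uc); apply: eq_card => v; rewrite inE.
Qed.

Lemma cycle_nonempty C : cycle_of o C -> exists u, u \in C.
Proof. by move=> [[|u c] [] // _ _ ->]; exists u; rewrite inE mem_head. Qed.

Hypothesis oI : injective o.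

Lemma iter_order_min u r : 0 < r < order o u -> iter r o u != u.
Proof.
case/andP=> r0 ru; apply/eqP => E.
by move: r0; rewrite -(findex_iter ru) E findex0.
Qed.

Lemma has_orderE u r : has_order o u r = (r == order o u).
Proof.
apply/and3P/eqP => [[r0 /eqP E /forallP H]|->]; last first.
  split; first exact: order_gt0; first by rewrite iter_order.
  by apply/forallP => s; apply/implyP => s0; rewrite iter_order_min // s0 ltn_ord.
case: (ltngtP r (order o u)) => // lt.
  by have := @iter_order_min u r; rewrite r0 lt E eqxx => /(_ isT).
by have := H (Ordinal lt); rewrite /= order_gt0 iter_order // eqxx.
Qed.

End Orders.

(** Both claims of the theorem reduce to this form: minimality supplies the last hypothesis, which
    is vacuous for [d = 3]. *)
Lemma excess_one_trichotomy k d (T : finType) (e : rel T) (o : T -> T) :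
  1 < k -> outlier_function e k o -> excess_one e d k ->
  (forall d' (T' : finType) (e' : rel T'), 2 < d' < d -> ~ excess_one e' d' k) ->
  outlier_regular o \/ unique_transposition o \/ min_order_dicycle k e o.
Proof.
move=> k2 ho eo dmin; have [geo _ cT] := eo.
have outd := excess_one_outdegree geo ho (ltnW k2) eo.
have [|ind] := outlier_dichotomy geo ho k2 outd; first by left.
have oI := regular_outlier_inj geo ho outd ind.
have oA := outlier_aut geo ho outd ind.
have /card_gt0P[x0 _] : 0 < #|T| by rewrite cT.
have [x _ xmin] := arg_minnP (order o) (isT : xpredT x0).
set w := order o x in xmin.
pose S := [set u | has_order o u w].
have inS u : (u \in S) = (w == order o u) by rewrite inE has_orderE.
(* A vertex fixed by [iter w o] has order at most [w], and [w] is the least order. *)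
have SE u : (u \in S) = (iter w o u == u).
  rewrite inS; apply/eqP/eqP => [->|E]; first exact: iter_order.
  apply/eqP; rewrite eqn_leq xmin //= leqNgt; apply/negP => lt.
  have := @iter_order_min _ o u w; rewrite order_gt0 lt E eqxx.
  by move/(_ isT).
have fA u v : e u v -> e (iter w o u) (iter w o v).
  by move=> uv; elim: (w) => //= i; rewrite oA.
have fo u : iter w o (o u) = o (iter w o u) by rewrite -iterSr -iterS.
have idx : has_index o w.
  split=> [|u r]; first by exists x; rewrite has_orderE.
  by rewrite has_orderE // => /eqP->; apply: xmin.
have xS : x \in S by rewrite inS.
pose e' := @sub_rel _ e S; pose o' := sub_outlier SE fo.
have geo' : geodetic e' k := sub_geodetic geo (S := S).
have ho' : outlier_function e' k o' := sub_outlier_function geo ho SE fA fo.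
have oI' : injective o' by move=> u v /(congr1 val) /= /oI /val_inj.
have oA' u v : e' (o' u) (o' v) = e' u v by rewrite /e' /sub_rel /= oA.
pose u0 : {u | u \in S} := Sub x xS.
have [D outD] : exists D, forall u, outdegree e' u = D.
  exists (outdegree e' u0) => u.
  have E := outdegree_indegree geo' ho' oI' oA'.
  by rewrite (E u u0) (E u0 u0).
have cardD : #|{: {u | u \in S}}| = (moore_bound D k).+1.
  by apply: (card_outlier_regular geo' ho' outD); apply/card_gt0P; exists u0.
have cS : #|S| = (moore_bound D k).+1 by rewrite -cardD card_sig.
have leD : D <= d.
  rewrite -(outD u0) -(outd x) /outdegree -(card_imset _ val_inj).
  by apply/subset_leq_card/subsetP => _ /imsetP[v + ->]; rewrite !inE.
(* If [D = d], then [S] has as many vertices as [T], so every cycle has length [w]. *)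
have [Dd|Dd] := eqVneq D d.
  have ST : S = [set: T].
    by apply/eqP; rewrite eqEcard subsetT cardsT cT cS Dd leqnn.
  have cw C : cycle_of o C -> #|C| = w.
    move=> cC; have [u uC] := cycle_nonempty cC.
    by rewrite (card_cycle cC uC); apply/esym/eqP; rewrite -inS ST inE.
  by left => C C' /cw-> /cw->.
right; case: D outD cardD cS leD Dd => [|[|[|D]]] outD cardD cS leD Dd.
(* Case [D = 0]: [S] has two vertices, [x] and [o x], so [w = 2]. The vertices of any transposition
   then have order [w] and lie in [S]. *)
- left; exists S.
  have S2 : #|S| = 2.
    by rewrite cS moore_bound0.
  have oxS : o x \in S by apply: (outlier_fixed SE fo).
  have xox : x != o x by rewrite eq_sym (outlier_neq ho).
  have oox : o (o x) = x.
    case: (card2_mem S2 xS oxS xox (outlier_fixed SE fo oxS)) => // E.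
    by have := outlier_neq ho (o x); rewrite E eqxx.
  have cycS : cycle_of o S.
    exists [:: x; o x]; split=> //.
      by apply/andP; split; rewrite /= ?inE ?oox ?eqxx ?xox.
    apply/setP => v; rewrite [RHS]inE !in_cons in_nil orbF.
    apply/idP/orP => [vS|[] /eqP-> //].
    by case: (card2_mem S2 xS oxS xox vS) => ->; rewrite eqxx; [left | right].
  split=> // C [cC C2]; apply/eqP; rewrite eq_sym eqEcard S2 C2 andbT.
  by apply/subsetP => v vC; rewrite inS -(card_cycle cC vC) C2 -S2 (card_cycle cycS xS).
(* Case [D = 1]: the cycle found in the subtype is carried to [T] along [val]. *)
- right; exists w; split=> //.
  have [c [uc sc fc nc]] := degree1_dicycle geo' ho' k2 oI' oA' u0 outD.
  have mc v : (v \in map val c) = (v \in S).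
    apply/mapP/idP => [[u _ ->]|vS]; first exact: valP.
    by exists (Sub v vS); rewrite ?fc ?inE.
  exists (map val c); split; rewrite ?(map_inj_uniq val_inj) ?size_map //.
  move=> u v uS vS; have := nc (Sub u uS) (Sub v vS).
  rewrite !inE => /(_ isT isT) /= E; rewrite [LHS]E -(inj_eq val_inj) /=.
  by rewrite -(next_map val_inj uc) SubK.
- case: (degree2_absurd geo' ho' k2 oA' outD _ u0) => v.
  by rewrite -(outdegree_indegree geo' ho' oI' oA' u0 v) outD.
(* The remaining degrees satisfy [2 < D < d], and the subdigraph contradicts minimality. *)
- case: (dmin D.+3 _ e') => //; first by rewrite /= ltn_neqAle Dd leD.
  by split=> //; split=> [u|]; [rewrite outD | exists u0].
Qed.

Theorem corollary10 (k : nat) (T : finType) (e : rel T) (o : T -> T)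
    (ho : outlier_function e k o) :
  (minimal_excess_one k e ->
     outlier_regular o \/ unique_transposition o \/ min_order_dicycle k e o)
  /\
  (2 <= k -> excess_one e 3 k ->
     outlier_regular o \/ unique_transposition o \/ min_order_dicycle k e o).
Proof.
split=> [[d [[k2 _ _ d3 eo] dmin]]|k2 eo].
  apply: (excess_one_trichotomy k2 ho eo) => d' T' e' /andP[d'3 lt] eo'.
  by have := dmin d' d'3 (ex_intro _ T' (ex_intro _ e' eo')); rewrite leqNgt lt.
apply: (excess_one_trichotomy k2 ho eo) => d' T' e' /andP[d'3].
by rewrite ltnNge d'3.
Qed.
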